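(* Let $\mathcal{H}$ be an infinite-dimensional, separable, complex Hilbert space. There exists a normal operator \[ D=\begin{bmatrix} D_1 & D_2 \\ 0 & D_4 \end{bmatrix} \] in $\mathcal{B}(\mathcal{H}\oplus \mathcal{H})$ such that $D_2$ is a quasiaffinity.
   Context: $\mathcal{B}(\mathcal{H}\oplus\mathcal{H})$ denotes the bounded linear operators on $\mathcal{H}\oplus\mathcal{H}$; block entries are taken relative to this direct sum, i.e. $D(x,y)=(D_1x+D_2y,\,D_4y)$. A bounded operator is a quasiaffinity if it is injective and has dense range. *)

(* Defs.v *)
From HB Require Import structures.
From mathcomp Require Import all_boot all_order all_algebra.
From mathcomp Require Import complex.
From mathcomp Require Import boolp classical_sets cardinality reals.
From mathcomp Require Import prodnormedzmodule topology normedtype.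

Set Implicit Arguments.
Unset Strict Implicit.
Unset Printing Implicit Defensive.

Import Order.TTheory GRing.Theory Num.Theory.
Import numFieldNormedType.Exports.

Local Open Scope classical_set_scope.
Local Open Scope ring_scope.

Section DirectSum.
Variables (C : numClosedFieldType) (U V : lmodType C).
Variables (f : {dot U for Num.conj}) (g : {dot V for Num.conj}).

Definition dsum_dot (u v : U * V) : C := f u.1 v.1 + g u.2 v.2.

Fact dsum_dot_bilinear :
  bilinear_for ( *%R : GRing.Scale.law _ _) (Num.conj \; *%R : GRing.Scale.law _ _)
    dsum_dot.
Proof.
split=> w a u v; rewrite /dsum_dot /=.
- by rewrite !linearPl /= mulrDr addrACA.
- by rewrite !linearPr /= mulrDr addrACA.
Qed.

HB.instance Definition _ :=
  bilinear_isBilinear.Build C (U * V)%type (U * V)%type C _ _ dsum_dot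
    dsum_dot_bilinear.

Fact dsum_dot_hermitian (u v : U * V) :
  dsum_dot u v = (-1) ^+ false * (dsum_dot v u)^*.
Proof.
by rewrite /dsum_dot expr0 mul1r rmorphD /= (hermC f) (hermC g) /= !expr0 !mul1r.
Qed.

HB.instance Definition _ :=
  isHermitianSesquilinear.Build C (U * V)%type false Num.conj dsum_dot
    dsum_dot_hermitian.

Fact dsum_dot_gt0 (u : U * V) : u != 0 -> 0 < dsum_dot u u.
Proof.
move=> u0; rewrite lt_def addr_ge0 ?dnorm_ge0 // andbT.
rewrite paddr_eq0 ?dnorm_ge0 // !dnorm_eq0.
by apply: contraNN u0 => /andP[/eqP u1 /eqP u2]; rewrite (surjective_pairing u) u1 u2.
Qed.

HB.instance Definition _ :=
  isDotProduct.Build C (U * V)%type dsum_dot dsum_dot_gt0.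

End DirectSum.

(* Forms {dot U for Num.conj} are linear in the first argument and conjugate
   linear in the second. A complete normed module over R[i] with a form satisfying
   [hilbert_norm] is a complex Hilbert space. *)
Definition hilbert_norm (C : numClosedFieldType) (H : normedModType C)
  (dot : {dot H for Num.conj}) := forall x, dot x x = `|x| ^+ 2.

(* The normedModType structure of [H * K] carries the maximum norm, not the
   Hilbert norm z |-> sqrt (dsum_dot z z) of the direct sum. The two norms are
   equivalent, so the topology of [H * K] and the bounded operators on it are
   those of the Hilbert direct sum. Adjoints always refer to [dsum_dot]. *)
Lemma dsum_norm_equiv (C : numClosedFieldType) (H K : normedModType C)
    (f : {dot H for Num.conj}) (g : {dot K for Num.conj})
    (z : (H * K)%type : normedModType C) :
  hilbert_norm f -> hilbert_norm g ->
  `|z| ^+ 2 <= dsum_dot f g z z <= 2 * `|z| ^+ 2.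
Proof.
move=> hf hg; rewrite /dsum_dot hf hg prod_normE /=.
have /orP[h|h] : (`|z.1| <= `|z.2|) || (`|z.2| <= `|z.1|).
  by apply: real_leVge; exact: normr_real.
- rewrite max_r ?lerDr ?exprn_ge0 //=; rewrite (_ : 2 = 1 + 1) // mulrDl mul1r lerD2r.
  by rewrite lerXn2r ?nnegrE.
rewrite max_l ?lerDl ?exprn_ge0 //=; rewrite (_ : 2 = 1 + 1) // mulrDl mul1r lerD2l.
by rewrite lerXn2r ?nnegrE.
Qed.

Definition separable (T : topologicalType) :=
  exists2 A : set T, countable A & dense A.

Definition finite_dimensional (K : nzRingType) (V : lmodType K) :=
  exists (n : nat) (e : 'I_n -> V),
    forall x, exists c : 'I_n -> K, x = \sum_(i < n) c i *: e i.

(* By [linear_boundedP], this is the existence of a constant r such that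
   `|T x| <= r * `|x| for all x. *)
Definition bounded_operator (K : numFieldType) (V W : normedModType K)
  (T : {linear V -> W}) := bounded_near T (nbhs (0 : V)).

Definition is_adjoint (C : numClosedFieldType) (V : lmodType C)
    (dot : {dot V for Num.conj}) (T S : V -> V) :=
  forall x y, dot (T x) y = dot x (S y).

(* S is the adjoint of T: it is unique, since the form is definite. *)
Definition normal_operator (C : numClosedFieldType) (V : normedModType C)
    (dot : {dot V for Num.conj}) (T : {linear V -> V}) :=
  bounded_operator T /\
  exists S : {linear V -> V},
    [/\ bounded_operator S, is_adjoint dot T S & forall x, S (T x) = T (S x)].

Definition quasiaffinity (K : numFieldType) (V W : normedModType K)
    (T : {linear V -> W}) :=
  [/\ bounded_operator T, injective T & dense (range T)].

(* Main.v *)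
From HB Require Import structures.
Require Import Defs.
From mathcomp Require Import all_boot all_order all_algebra.
From mathcomp Require Import ring.
From mathcomp Require Import complex.
From mathcomp Require Import boolp classical_sets functions cardinality reals.
From mathcomp Require Import prodnormedzmodule topology normedtype.

(** Let N be multiplication by z on L^2 of the two circles |z| = 1 and
    |z| = sqrt 2, each with normalized arc length. N is normal. At frequency n the
    space is C^2, and N sends frequency n to frequency n + 1 by diag(1, sqrt 2).
    Let M be the closed span of the powers z^n, n in Z. At frequency n it is the
    line of (1, sqrt 2 ^ n), of squared length [moment n] = 1 + 2^n, and its
    orthogonal complement is the line of (- sqrt 2 ^ n, 1). M is invariant under
    N, but N moves the orthogonal line at frequency n to a line that is not
    orthogonal to M at frequency n + 1. So relative to M and its complement, N is
    upper triangular, its three nonzero blocks are bilateral weighted shifts, and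
    the weights [weight2 n] of the corner block are all positive. Such a shift is
    injective and its range contains every basis vector: it is a quasiaffinity.
    (The weights tend to 0 at both ends, so it is not invertible.)

    The proof works with the three shifts only. With respect to the adjoint
    shifts, normality of the block operator amounts to the three identities
    [weight1_sqr], [weight4_sqr] and [weight_intertwine] between the weights.

    It remains to have such shifts on an abstract H. Gram-Schmidt orthogonalization
    of a dense sequence gives an orthonormal basis of H ([separable_basis]),
    which is reindexed by the integers. A weighted shift T is determined by the
    coefficients of T x. On finite combinations of basis vectors these
    coefficients are realized by a finite sum, and Bessel's inequality makes the
    resulting relation Lipschitz, so completeness of H extends it to all of H
    ([lipschitz_relation_extension], [exists_weighted_permutation]). *)

Set Implicit Arguments.
Unset Strict Implicit.
Unset Printing Implicit Defensive.

Import Order.TTheory GRing.Theory Num.Theory.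
Import numFieldNormedType.Exports.

Local Open Scope ring_scope.

(** * Finite orthonormal families *)

Section FourierSums.
Variables (C : numClosedFieldType) (H : normedModType C).
Variables (dot : {dot H for Num.conj}) (dot_norm : hilbert_norm dot).

Lemma dotC x y : dot x y = (dot y x)^*.
Proof. by rewrite (hermC dot) expr0 mul1r. Qed.

Lemma dot_sym0 x y : dot x y = 0 -> dot y x = 0.
Proof. by move=> xy0; rewrite dotC xy0 rmorph0. Qed.

Lemma pythagoras x y : dot x y = 0 -> `|x + y| ^+ 2 = `|x| ^+ 2 + `|y| ^+ 2.
Proof. by move=> xy0; rewrite -!dot_norm hnormDd. Qed.

(** Cauchy-Schwarz for a unit vector u: the vector dot x u *: u is the orthogonal
    projection of x on the line of u, hence not longer than x. *)
Lemma norm_dot x u : `|u| = 1 -> `|dot x u| <= `|x|.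
Proof.
move=> u1; pose p := dot x u *: u.
have pP : dot p (x - p) = 0.
  by rewrite linearZl_LR /= linearBr linearZr_LR /= dot_norm u1 expr1n mulr1
             -dotC subrr mulr0.
have := pythagoras pP; rewrite subrKC normrZ u1 mulr1 => E.
by rewrite -ler_sqr ?nnegrE// E lerDl exprn_ge0.
Qed.

Lemma cauchy_schwarz x y : `|dot x y| <= `|x| * `|y|.
Proof.
have [->|y0] := eqVneq y 0; first by rewrite linear0r !normr0 mulr0.
have ny0 : `|y| != 0 by rewrite normr_eq0.
have u1 : `| `|y|^-1 *: y| = 1 by rewrite normrZ normfV normr_id mulVf.
have := norm_dot x u1; rewrite linearZr_LR /= normrM norm_conjC normfV normr_id.
by rewrite mulrC ler_pdivrMr // normr_gt0.
Qed.

Variables (I : eqType) (e : I -> H).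

Definition orthonormal_on (s : seq I) :=
  {in s &, forall i j, dot (e i) (e j) = (i == j)%:R}.

Definition fourier (s : seq I) (x : H) : H := \sum_(i <- s) dot x (e i) *: e i.

Lemma fourierB s x y : fourier s (x - y) = fourier s x - fourier s y.
Proof.
by rewrite /fourier -sumrB; apply: eq_bigr => i _; rewrite linearBl scalerBl.
Qed.

Variables (s : seq I) (s_uniq : uniq s) (s_on : orthonormal_on s).

Lemma dot_fourier x y :
  dot (fourier s x) y = \sum_(i <- s) dot x (e i) * dot (e i) y.
Proof.
by rewrite linear_sumlz /=; apply: eq_bigr => i _; rewrite linearZl_LR.
Qed.

Lemma dot_fourier_basis x i : i \in s -> dot (fourier s x) (e i) = dot x (e i).
Proof.
move=> si; rewrite dot_fourier (bigD1_seq i) //= s_on // eqxx mulr1.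
rewrite big_seq_cond big1 ?addr0 // => j /andP[sj /negPf ji].
by rewrite s_on // ji mulr0.
Qed.

Lemma dot_residual_basis x i : i \in s -> dot (x - fourier s x) (e i) = 0.
Proof. by move=> si; rewrite linearBl /= dot_fourier_basis // subrr. Qed.

Lemma dot_residual_fourier x y : dot (x - fourier s x) (fourier s y) = 0.
Proof.
rewrite linear_sumr /= big_seq big1 // => i si.
by rewrite linearZr_LR /= dot_residual_basis // mulr0.
Qed.

Lemma norm_fourier x :
  `|fourier s x| ^+ 2 = \sum_(i <- s) `|dot x (e i)| ^+ 2.
Proof.
rewrite -dot_norm dot_fourier big_seq [RHS]big_seq; apply: eq_bigr => i si.
by rewrite [dot (e i) _]dotC dot_fourier_basis // -normCK.
Qed.

Lemma pythagoras_fourier x :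
  `|x| ^+ 2 = `|fourier s x| ^+ 2 + `|x - fourier s x| ^+ 2.
Proof.
rewrite -pythagoras ?subrKC //.
by apply: dot_sym0; exact: dot_residual_fourier.
Qed.

Lemma norm_residual_le x : `|x - fourier s x| <= `|x|.
Proof.
by rewrite -ler_sqr ?nnegrE// [leRHS]pythagoras_fourier lerDr exprn_ge0.
Qed.

(** Among the vectors of the span, the Fourier sum is the closest one to x. The
    equation y = fourier s y says that y lies in the span of the family. *)
Lemma residual_le_dist x y : y = fourier s y ->
  `|x - fourier s x| <= `|x - y|.
Proof.
move=> yE; have -> : x - fourier s x = (x - y) - fourier s (x - y).
  by rewrite fourierB -yE opprB addrA subrK.
exact: norm_residual_le.
Qed.

(** Bessel's inequality. *)
Lemma norm_fourier_le x : `|fourier s x| <= `|x|.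
Proof.
by rewrite -ler_sqr ?nnegrE// [leRHS]pythagoras_fourier lerDl exprn_ge0.
Qed.

End FourierSums.

(** * Orthonormal bases *)

Section OrthonormalBases.
Variables (C : numClosedFieldType) (H : normedModType C).
Variables (dot : {dot H for Num.conj}) (dot_norm : hilbert_norm dot).

(** Density of the span is stated with finite Fourier sums, so that no infinite
    sum over the index type has to be given a meaning. *)
Definition orthonormal_basis (I : eqType) (e : I -> H) :=
  (forall i j, dot (e i) (e j) = (i == j)%:R) /\
  forall (x : H) (eps : C), 0 < eps ->
    exists2 s : seq I, uniq s & `|x - fourier dot e s x| < eps.

Variables (I : eqType) (e : I -> H) (e_basis : orthonormal_basis e).

Lemma basis_orthonormal_on s : orthonormal_on dot e s.
Proof. by move=> i j _ _; exact: e_basis.1. Qed.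

Lemma norm_basis i : `|e i| = 1.
Proof.
apply/eqP; rewrite -(@eqrXn2 _ 2) // expr1n -dot_norm e_basis.1 eqxx //.
Qed.

(** Parseval's identity as an inequality: the norm is monotone in the absolute
    values of the coefficients, up to an injective relabelling of the basis. All
    bounds on weighted shifts come from here. *)
Lemma norm_le_coef (M : C) (x y : H) (tau : I -> I) : 0 <= M -> injective tau ->
    (forall i, `|dot y (e i)| <= M * `|dot x (e (tau i))|) ->
  `|y| <= M * `|x|.
Proof.
move=> M0 tau_inj coef; apply/ler_addgt0Pr => eps eps0.
have [s us ys] := e_basis.2 y eps eps0.
rewrite -(subrKC (fourier dot e s y) y) (le_trans (ler_normD _ _)) //.
apply: lerD; last exact: ltW.
have on := @basis_orthonormal_on.
rewrite (@le_trans _ _ (M * `|fourier dot e (map tau s) x|)) //; last first.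
  by rewrite ler_wpM2l // norm_fourier_le ?map_inj_uniq.
rewrite -ler_sqr ?nnegrE ?mulr_ge0// exprMn !norm_fourier ?map_inj_uniq//.
rewrite big_map mulr_sumr ler_sum // => i _.
by rewrite -exprMn ler_sqr ?nnegrE ?mulr_ge0.
Qed.

Lemma basis_total x : (forall i, dot x (e i) = 0) -> x = 0.
Proof.
move=> x0; apply/eqP; rewrite -normr_le0 -(mul0r `|x|).
by apply: (@norm_le_coef 0 x x id) => // i; rewrite x0 normr0 mul0r.
Qed.

Lemma basis_eq x y : (forall i, dot x (e i) = dot y (e i)) -> x = y.
Proof.
move=> xy; apply/eqP; rewrite -subr_eq0; apply/eqP/basis_total => i.
by rewrite linearBl /= xy subrr.
Qed.

End OrthonormalBases.

(** * Gram-Schmidt orthogonalization of a dense sequence *)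

Section GramSchmidt.
Variables (C : numClosedFieldType) (H : normedModType C).
Variables (dot : {dot H for Num.conj}) (dot_norm : hilbert_norm dot).
Variable d : nat -> H.
Hypothesis d_dense : forall (x : H) (eps : C), 0 < eps ->
  exists k, `|x - d k| < eps.
Hypothesis H_infinite : ~ finite_dimensional H.

(** Otherwise the dense sequence d would lie in the span of n vectors; x is as close
    to its Fourier sum as to any d k, so the span would be all of H. *)
Lemma exists_residual (e : nat -> H) n : orthonormal_on dot e (iota 0 n) ->
  exists k, d k != fourier dot e (iota 0 n) (d k).
Proof.
move=> on; apply: contrapT => /forallNP dP; apply: H_infinite.
exists n, (fun i => e i) => x; exists (fun i => dot x (e i)).
rewrite -(big_mkord xpredT (fun i => dot x (e i) *: e i)) /index_iota subn0.
rewrite -/(fourier dot e (iota 0 n) x).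
apply/eqP; rewrite -subr_eq0 -normr_le0; apply/ler_addgt0Pr => eps eps0.
have [k xk] := d_dense x eps0; rewrite add0r.
apply: le_trans (ltW xk).
apply: (residual_le_dist dot_norm (iota_uniq _ _) on).
by have /negP/negPn/eqP := dP k.
Qed.

(** The step normalizes the residual r of the first term d k outside the span. It
    keeps the earlier terms in the span, and it adds d k itself because
    dot (d k) (e n) = |r|. *)
Lemma gram_schmidt_step (e : nat -> H) n k
    (r := d k - fourier dot e (iota 0 n) (d k)) :
  orthonormal_on dot e (iota 0 n) -> r != 0 -> e n = `|r|^-1 *: r ->
  (forall j, (j < k)%N -> d j = fourier dot e (iota 0 n) (d j)) ->
  orthonormal_on dot e (iota 0 n.+1) /\
  forall j, (j <= k)%N -> d j = fourier dot e (iota 0 n.+1) (d j).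
Proof.
move=> on r0 en dj; have nr0 : `|r| != 0 by rewrite normr_eq0.
have iE : iota 0 n.+1 = rcons (iota 0 n) n by rewrite -addn1 iotaD cats1.
have re i : i \in iota 0 n -> dot r (e i) = 0.
  exact: dot_residual_basis (iota_uniq _ _) on _ _.
have rf x : dot (fourier dot e (iota 0 n) x) r = 0.
  by apply: dot_sym0; exact: dot_residual_fourier (iota_uniq _ _) on _ _.
have dotn x : dot x (e n) = `|r|^-1 * dot x r.
  by rewrite en linearZr_LR /= conj_Creal ?realV ?normr_real.
have enx i : i \in iota 0 n -> dot (e i) (e n) = 0.
  by move=> si; rewrite dotn dot_sym0 ?mulr0 // re.
split.
  move=> i j; rewrite iE !mem_rcons !inE => /predU1P[->|si] /predU1P[->|sj].
  - rewrite dotn en linearZl_LR /= dot_norm eqxx mulrA -invfM -expr2 mulVf //.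
    by rewrite expf_neq0.
  - rewrite dot_sym0 ?enx //; move: sj; rewrite mem_iota /= add0n => jn.
    by rewrite gtn_eqF.
  - rewrite enx //; move: si; rewrite mem_iota /= add0n => jn.
    by rewrite ltn_eqF.
  - exact: on.
move=> j; rewrite iE /fourier big_rcons /= -/(fourier dot e (iota 0 n) (d j)).
rewrite leq_eqVlt => /predU1P[->|jk].
  have -> : dot (d k) (e n) = `|r|.
    rewrite dotn -[d k](subrK (fourier dot e (iota 0 n) (d k))) -/r.
    by rewrite linearDl /= rf addr0 dot_norm expr2 mulKf.
  by rewrite en scalerA mulfV // scale1r subrKC.
have -> : dot (d j) (e n) = 0 by rewrite (dj _ jk) dotn rf mulr0.
by rewrite scale0r addr0 -dj.
Qed.

(** The default value 0 of [xget] is never reached: by [exists_residual] the set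
    is nonempty for the lists that occur. *)
Definition gs_index (s : seq H) : nat :=
  xget 0%N [set k | d k != fourier dot id s (d k) /\
    forall j, (j < k)%N -> d j = fourier dot id s (d j)].

Definition gs_next (s : seq H) : H :=
  let r := d (gs_index s) - fourier dot id s (d (gs_index s)) in `|r|^-1 *: r.

Fixpoint gs_list n : seq H :=
  if n is m.+1 then rcons (gs_list m) (gs_next (gs_list m)) else [::].

Definition gram_schmidt n := gs_next (gs_list n).

Lemma fourier_gs_list n :
  fourier dot id (gs_list n) =1 fourier dot gram_schmidt (iota 0 n).
Proof.
move=> x; have -> : gs_list n = map gram_schmidt (iota 0 n); last first.
  by rewrite /fourier big_map.
elim: n => // n IHn.
by rewrite -[in RHS]addn1 iotaD map_cat -IHn /= cats1.
Qed.

(** The index treated at stage n is at least n, since the first n terms are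
    already in the span. This is why every term is reached. *)
Lemma gram_schmidt_spec n : orthonormal_on dot gram_schmidt (iota 0 n) /\
  forall j, (j < n)%N -> d j = fourier dot gram_schmidt (iota 0 n) (d j).
Proof.
elim: n => [|n [on dn]]; first by split.
have [k [kn min_k]] : exists k,
    d k != fourier dot id (gs_list n) (d k) /\
    forall j, (j < k)%N -> d j = fourier dot id (gs_list n) (d j).
  have [k0 k0P] := exists_residual on.
  have [k kP kmin] := find_ex_minn (ex_intro (fun k => d k !=
    fourier dot gram_schmidt (iota 0 n) (d k)) k0 k0P).
  exists k; rewrite fourier_gs_list; split=> // j jk.
  apply/eqP; rewrite fourier_gs_list; apply: contraLR jk => /kmin.
  by rewrite -leqNgt.
have [] := xgetPex 0%N (ex_intro _ k (conj kn min_k) : exists k, [set k |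
  d k != fourier dot id (gs_list n) (d k) /\
  forall j, (j < k)%N -> d j = fourier dot id (gs_list n) (d j)]%classic k).
rewrite -/(gs_index (gs_list n)) => {kn min_k} {}kn min_k.
have [||//||on' dn'] := @gram_schmidt_step gram_schmidt n (gs_index (gs_list n)).
- exact: on.
- by rewrite subr_eq0 -fourier_gs_list.
- by rewrite -fourier_gs_list.
- by move=> j /min_k; rewrite fourier_gs_list.
split=> // j; rewrite ltnS => jn; apply: dn'; apply: leq_trans jn _.
rewrite leqNgt; apply: contra kn => /dn {1}->.
by rewrite fourier_gs_list.
Qed.

Lemma gram_schmidt_basis : orthonormal_basis dot gram_schmidt.
Proof.
split=> [i j|x eps eps0].
  by apply: (gram_schmidt_spec (maxn i j).+1).1; rewrite mem_iota /= add0n ltnS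
    ?leq_maxl ?leq_maxr.
have [k xk] := d_dense x eps0; have [on dP] := gram_schmidt_spec k.+1.
exists (iota 0 k.+1); first exact: iota_uniq.
apply: le_lt_trans xk; apply: (residual_le_dist dot_norm (iota_uniq _ _) on).
exact: dP.
Qed.

End GramSchmidt.

Section SeparableBasis.
Variables (C : numClosedFieldType) (H : normedModType C).
Variables (dot : {dot H for Num.conj}) (dot_norm : hilbert_norm dot).

Lemma separable_sequence : separable H ->
  exists d : nat -> H, forall (x : H) (eps : C), 0 < eps ->
    exists k, `|x - d k| < eps.
Proof.
case=> A Acount Adense.
have Aball (x : H) (eps : C) : 0 < eps -> exists2 y, A y & `|x - y| < eps.
  move=> eps0; have [//||y [xy Ay]] := Adense (ball x eps).
  - by exists x; exact: ballxx.
  - exact: ball_open.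
  by exists y => //; move: xy; rewrite -ball_normE.
move/pfcard_geP: Acount => [A0|[f]].
  by have [y] := Aball 0 1 ltr01; rewrite A0.
exists f => x eps /(Aball x)[y Ay xy].
by have [k _ fk] := (@surj _ _ _ _ f _ Ay); exists k; rewrite fk.
Qed.

Lemma separable_basis : separable H -> ~ finite_dimensional H ->
  exists e : nat -> H, orthonormal_basis dot e.
Proof.
move=> /separable_sequence[d d_dense] H_infinite.
by exists (gram_schmidt dot d); exact: gram_schmidt_basis.
Qed.

Lemma orthonormal_basis_reindex (I J : eqType) (f : J -> I) (e : I -> H) :
  bijective f -> orthonormal_basis dot e -> orthonormal_basis dot (e \o f).
Proof.
case=> g fK gK [on span]; split=> [i j|x eps eps0] /=.
  by rewrite on (can_eq fK).
have [s us xs] := span x eps eps0; exists (map g s).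
  by rewrite map_inj_uniq //; exact: can_inj gK.
by move: xs; rewrite /fourier big_map;
  under [in X in _ -> X]eq_bigr do rewrite /= gK.
Qed.

Lemma int_nat_bijective :
  bijective (fun n : int => match n with Posz m => m.*2 | Negz m => m.*2.+1 end).
Proof.
exists (fun n => if odd n then Negz n./2 else Posz n./2).
  by case=> m /=; rewrite ?odd_double /= ?uphalf_double ?doubleK.
by move=> n; case: ifP => on /=; have := odd_double_half n; rewrite on.
Qed.

End SeparableBasis.

(** * Extension of densely defined Lipschitz maps *)

Section LipschitzExtension.
Variables (C : numFieldType) (V : normedModType C) (W : completeNormedModType C).

(** The images of the points of the domain near x generate a Cauchy filter; y is
    its limit. The conclusion says that (x, y) is in the closure of the graph G. *)
Lemma lipschitz_relation_extension (G : V -> W -> Prop) (M : C) : 0 <= M ->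
    (forall x y x' y', G x y -> G x' y' -> `|y - y'| <= M * `|x - x'|) ->
    (forall (x : V) (eps : C), 0 < eps ->
       exists x', `|x - x'| < eps /\ exists y', G x' y') ->
  forall x, exists y, forall eps, 0 < eps ->
    exists x' y', [/\ G x' y', `|x - x'| < eps & `|y - y'| < eps].
Proof.
move=> M0 lip dom x.
pose F : set_system W := fun B => nbhs x (fun x' => forall y', G x' y' -> B y').
have domN (P : V -> Prop) : nbhs x P -> exists x' y', G x' y' /\ P x'.
  move=> /nbhs_normP[/= eps eps0 sP]; have [x' [xx' [y' Gx']]] := dom x eps eps0.
  by exists x', y'; split=> //; apply: sP.
have FF : ProperFilter F.
  apply: Build_ProperFilter_ex => [B FB|].
    by have [x' [y' [Gx' /(_ y' Gx')]]] := domN _ FB; exists y'.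
  split; first exact: nearW.
    rewrite /F => A B FA FB; near=> x' => y' G'.
    by split; move: y' G'; near: x'.
  by rewrite /F => A B AB; apply: filterS => x' A' y' /A'; exact: AB.
have Fcauchy : cauchy F.
  apply: cauchy_exP => eps eps0.
  (* Two points within del of x are 2 * del apart, so their images are within
     2 * M * del < eps. *)
  pose del := eps / (M + M + 1).
  have MM1 : 0 < M + M + 1 by rewrite ltr_wpDl ?addr_ge0.
  have del0 : 0 < del by rewrite divr_gt0.
  have [x0 [xx0 [y0 G0]]] := dom x del del0.
  exists y0; apply/nbhs_normP; exists del => //= x' xx' y' G'.
  rewrite -ball_normE /=; apply: le_lt_trans (lip _ _ _ _ G0 G') _.
  have : `|x0 - x'| <= del + del.
    rewrite -(subrK x x0) -addrA (le_trans (ler_normD _ _)) //.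
    by apply: lerD; apply: ltW => //; rewrite distrC.
  move=> /(ler_wpM2l M0)/le_lt_trans; apply.
  rewrite mulrDr -mulrDl /del mulrA ltr_pdivrMr // mulrC ltr_pM2l //.
  by rewrite ltrDl.
exists (lim F) => eps eps0.
have Flim : nbhs x (fun x' => forall y', G x' y' -> `|lim F - y'| < eps).
  by apply: (cauchy_cvg F Fcauchy); apply/nbhs_normP; exists eps.
have xeps : nbhs x (fun x' => `|x - x'| < eps) by apply/nbhs_normP; exists eps.
have [x' [y' [Gx' [xx' yy']]]] := domN _ (filterI xeps Flim).
by exists x', y'; split=> //; exact: yy'.
Unshelve. all: by end_near. Qed.

End LipschitzExtension.

Lemma bounded_operatorP (K : numFieldType) (V W : normedModType K)
    (T : {linear V -> W}) (M : K) :
  0 <= M -> (forall x, `|T x| <= M * `|x|) -> bounded_operator T.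
Proof.
move=> M0 TM; apply/linear_boundedP; near=> r => x.
apply: le_trans (TM x) _; rewrite ler_wpM2r //.
by near: r; apply: nbhs_pinfty_ge; exact: ger0_real.
Unshelve. all: by end_near. Qed.

(** * Weighted permutations of an orthonormal basis *)

Section WeightedPermutations.
Variables (C : numClosedFieldType) (H : completeNormedModType C).
Variables (dot : {dot H for Num.conj}) (dot_norm : hilbert_norm dot).
Variables (I : eqType) (e : I -> H) (e_basis : orthonormal_basis dot e).

(** T sends e (tau i) to b i *: e i. Prescribing the coefficients of T x, and not
    only the values on the basis, determines T without assuming continuity. *)
Definition weighted_permutation (b : I -> C) (tau : I -> I) (T : H -> H) :=
  forall x i, dot (T x) (e i) = b i * dot x (e (tau i)).

Variables (tau sigma : I -> I).
Hypotheses (tauK : cancel tau sigma) (sigmaK : cancel sigma tau).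
Variables (M : C) (M_ge0 : 0 <= M).

Lemma weighted_permutation_le (b : I -> C) (T : H -> H) :
  (forall i, `|b i| <= M) -> weighted_permutation b tau T ->
  forall x, `|T x| <= M * `|x|.
Proof.
move=> bM TP x; apply: (norm_le_coef dot_norm e_basis) (can_inj tauK) _ => // i.
by rewrite TP normrM ler_wpM2r.
Qed.

Lemma exists_weighted_permutation (b : I -> C) : (forall i, `|b i| <= M) ->
  exists T : {linear H -> H}, weighted_permutation b tau T.
Proof.
move=> bM.
pose G x y := forall i, dot y (e i) = b i * dot x (e (tau i)).
have lip x y x' y' : G x y -> G x' y' -> `|y - y'| <= M * `|x - x'|.
  move=> Gx Gx'; apply: (norm_le_coef dot_norm e_basis) (can_inj tauK) _ => // i.
  by rewrite !linearBl /= Gx Gx' -mulrBr normrM ler_wpM2r.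
(* The domain of G contains all finite combinations of basis vectors. *)
have dom x eps : 0 < eps -> exists x', `|x - x'| < eps /\ exists y', G x' y'.
  move=> eps0; have [s us xs] := e_basis.2 x eps eps0.
  exists (fourier dot e s x); split=> //.
  exists (\sum_(j <- s) (dot x (e j) * b (sigma j)) *: e (sigma j)) => i.
  rewrite dot_fourier linear_sumlz /= mulr_sumr; apply: eq_bigr => j _.
  rewrite linearZl_LR /= !e_basis.1.
  have -> : (sigma j == i) = (j == tau i) by rewrite -(can_eq tauK) sigmaK.
  by have [->|] := eqVneq j (tau i); rewrite ?mulr0 // tauK mulrCA mulrA.
have Gclosed x : exists y, G x y.
  have [y yP] := lipschitz_relation_extension M_ge0 lip dom x.
  exists y => i; apply/eqP; rewrite -subr_eq0 -normr_le0.
  apply/ler_addgt0Pr => eps eps0; rewrite add0r.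
  have M1 : 0 < 1 + M by rewrite ltr_pwDl.
  have [x' [y' [Gx' xx' yy']]] := yP (eps / (1 + M)) (divr_gt0 eps0 M1).
  have -> : dot y (e i) - b i * dot x (e (tau i)) =
      dot (y - y') (e i) - b i * dot (x - x') (e (tau i)).
    by rewrite !linearBl /= (Gx' i) mulrBr opprB addrA subrK.
  apply: le_trans (ler_normB _ _) _; rewrite normrM.
  have e1 := norm_basis dot_norm e_basis.
  rewrite -[leRHS](divfK (lt0r_neq0 M1)) mulrDr mulr1.
  apply: lerD; first exact: le_trans (norm_dot dot_norm _ (e1 i)) (ltW yy').
  rewrite mulrC; apply: ler_pM => //.
  exact: le_trans (norm_dot dot_norm _ (e1 _)) (ltW xx').
have [T TP] := choice Gclosed.
have T_linear : linear T.
  move=> a x y; apply: (basis_eq dot_norm e_basis) => i.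
  by rewrite linearPl /= !TP linearPl /= mulrDr mulrCA.
pose L : {linear H -> H} := HB.pack T (GRing.isLinear.Build _ _ _ _ T T_linear).
by exists L.
Qed.

(** The two sides of the adjoint identity agree when y is a finite combination of
    basis vectors, and both are bounded in y. *)
Lemma adjoint_weighted_permutation (b : I -> C) (T S : {linear H -> H}) :
  (forall i, `|b i| <= M) -> weighted_permutation b tau T ->
  weighted_permutation (fun i => (b (sigma i))^*) sigma S ->
  is_adjoint dot T S.
Proof.
move=> bM TP SP x y.
have Se i : S (e i) = (b i)^* *: e (tau i).
  apply: (basis_eq dot_norm e_basis) => j.
  rewrite SP linearZl_LR /= !e_basis.1.
  have -> : (tau i == j) = (i == sigma j) by rewrite -(can_eq sigmaK) tauK.
  by have [->|] := eqVneq i (sigma j); rewrite ?mulr0.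
have fourier_case s : dot (T x) (fourier dot e s y) = dot x (S (fourier dot e s y)).
  rewrite /fourier [S _]linear_sum !linear_sumr /=; apply: eq_bigr => i _.
  by rewrite [S _]linearZ !linearZr_LR /= Se linearZr_LR /= conjCK TP.
have T_le : `|T x| <= M * `|x| by exact: weighted_permutation_le bM TP x.
have S_le z : `|S z| <= M * `|z|.
  apply: (norm_le_coef dot_norm e_basis) (can_inj sigmaK) _ => // i.
  by rewrite SP normrM norm_conjC ler_wpM2r.
apply/eqP; rewrite -subr_eq0 -normr_le0.
apply/ler_addgt0Pr => eps eps0; rewrite add0r.
pose B := M * `|x| + `|x| * M.
have B1 : 0 < 1 + B by rewrite ltr_pwDl // addr_ge0 ?mulr_ge0.
have [s us ys] := e_basis.2 y (eps / (1 + B)) (divr_gt0 eps0 B1).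
set z := y - fourier dot e s y in ys.
have -> : dot (T x) y - dot x (S y) = dot (T x) z - dot x (S z).
  rewrite /z [S (_ - _)]linearB !linearBr /= fourier_case opprB addrA subrK //.
apply: (@le_trans _ _ (B * `|z|)).
  apply: le_trans (ler_normB _ _) _; rewrite mulrDl; apply: lerD.
    apply: le_trans (cauchy_schwarz dot_norm _ _) _.
    exact: ler_wpM2r.
  apply: le_trans (cauchy_schwarz dot_norm _ _) _.
  by rewrite -mulrA ler_wpM2l.
rewrite -[leRHS](divfK (lt0r_neq0 B1)) mulrC; apply: ler_pM => //.
- by rewrite addr_ge0 ?mulr_ge0.
- exact: ltW.
- by rewrite lerDr.
Qed.

End WeightedPermutations.

(** * Two by two block operators *)

Section BlockOperators.
Variables (C : numClosedFieldType) (H : normedModType C).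

Definition block (A11 A12 A21 A22 : H -> H) (z : (H * H)%type) : (H * H)%type :=
  (A11 z.1 + A12 z.2, A21 z.1 + A22 z.2).

Lemma block_linear (A11 A12 A21 A22 : {linear H -> H}) :
  linear (block A11 A12 A21 A22).
Proof.
move=> a x y; rewrite /block /=.
by apply: injective_projections => /=; rewrite !linearP scalerDr addrACA.
Qed.

HB.instance Definition _ (A11 A12 A21 A22 : {linear H -> H}) :=
  GRing.isLinear.Build _ _ _ _ (block A11 A12 A21 A22)
    (block_linear A11 A12 A21 A22).

Lemma block_bounded (A11 A12 A21 A22 : {linear H -> H}) (M : C) : 0 <= M ->
    (forall x, `|A11 x| <= M * `|x|) -> (forall x, `|A12 x| <= M * `|x|) ->
    (forall x, `|A21 x| <= M * `|x|) -> (forall x, `|A22 x| <= M * `|x|) ->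
  bounded_operator (block A11 A12 A21 A22).
Proof.
move=> M0 b11 b12 b21 b22.
apply: (@bounded_operatorP _ _ _ _ (M + M)) => [|z]; first exact: addr_ge0.
have cmp (u : (H * H)%type) : `|u.1| >=< `|u.2|.
  by apply: real_comparable; exact: normr_real.
have z1 : `|z.1| <= `|z| by rewrite prod_normE (comparable_le_max _ (cmp _)) lexx.
have z2 : `|z.2| <= `|z|.
  by rewrite prod_normE (comparable_le_max _ (cmp _)) lexx orbT.
have row (A B : H -> H) : (forall x, `|A x| <= M * `|x|) ->
    (forall x, `|B x| <= M * `|x|) -> `|A z.1 + B z.2| <= (M + M) * `|z|.
  move=> bA bB; rewrite (le_trans (ler_normD _ _)) // mulrDl lerD //.
    by rewrite (le_trans (bA _)) // ler_wpM2l.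
  by rewrite (le_trans (bB _)) // ler_wpM2l.
by rewrite [leLHS]prod_normE (comparable_ge_max _ (cmp _)) /= !row.
Qed.

Lemma block_adjoint (dot : {dot H for Num.conj})
    (A11 A12 A21 A22 B11 B12 B21 B22 : H -> H) :
  is_adjoint dot A11 B11 -> is_adjoint dot A12 B12 ->
  is_adjoint dot A21 B21 -> is_adjoint dot A22 B22 ->
  is_adjoint (dsum_dot dot dot) (block A11 A12 A21 A22) (block B11 B21 B12 B22).
Proof.
move=> a11 a12 a21 a22 x y; rewrite /block /= /dsum_dot /=.
by rewrite !linearDl !linearDr /= a11 a12 a21 a22 addrACA.
Qed.

End BlockOperators.

(** * The weights *)

Section Weights.
Variable C : numClosedFieldType.

(** The squared norm of z^n on the two circles |z| = 1 and |z| = sqrt 2. *)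
Definition moment (n : int) : C := 1 + 2 ^ n.
(** In the orthonormal bases of M and of its complement, multiplication by z sends
    the n-th vector of M to [weight1 n] times the next one, and the n-th vector of
    the complement to [weight2 n] times the next vector of M plus [weight4 n] times
    the next vector of the complement. *)
Definition weight1 n := sqrtC (moment (n + 1) / moment n).
Definition weight2 n := sqrtC (2 ^ n / (moment n * moment (n + 1))).
Definition weight4 n := sqrtC (2 * moment n / moment (n + 1)).

Lemma pow2_gt0 (n : int) : 0 < 2 ^ n :> C.
Proof. exact: exprz_gt0. Qed.

Lemma moment_gt0 n : 0 < moment n.
Proof. by rewrite ltr_wpDl // pow2_gt0. Qed.

Lemma moment_neq0 n : moment n != 0.
Proof. exact: lt0r_neq0 (moment_gt0 n). Qed.

Lemma pow2S (n : int) : 2 ^ (n + 1) = 2 * 2 ^ n :> C.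
Proof. by rewrite expfzDr ?pnatr_eq0 // expr1z mulrC. Qed.

Lemma weight1_ge0 n : 0 <= weight1 n.
Proof. by rewrite sqrtC_ge0 divr_ge0 // ltW // moment_gt0. Qed.

Lemma weight2_gt0 n : 0 < weight2 n.
Proof. by rewrite sqrtC_gt0 divr_gt0 ?mulr_gt0 ?moment_gt0 ?pow2_gt0. Qed.

Lemma weight4_ge0 n : 0 <= weight4 n.
Proof. by rewrite sqrtC_ge0 divr_ge0 ?mulr_ge0 // ltW // moment_gt0. Qed.

Lemma weight1_sqr n : weight1 (n + 1) ^+ 2 = weight1 n ^+ 2 + weight2 n ^+ 2.
Proof.
rewrite !sqrtCK; have := moment_neq0 (n + 1 + 1); have := moment_neq0 (n + 1).
have := moment_neq0 n; rewrite /moment !pow2S => ? ? ?; field; exact/andP.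
Qed.

Lemma weight4_sqr n :
  weight4 n ^+ 2 = weight4 (n + 1) ^+ 2 + weight2 (n + 1) ^+ 2.
Proof.
rewrite !sqrtCK; have := moment_neq0 (n + 1 + 1); have := moment_neq0 (n + 1).
have := moment_neq0 n; rewrite /moment !pow2S => ? ? ?; field; exact/andP.
Qed.

Lemma weight_intertwine n :
  weight1 (n + 1) * weight2 (n + 1) = weight4 n * weight2 n.
Proof.
have m_ge0 k := ltW (moment_gt0 k).
rewrite -!rootCMl ?divr_ge0 ?mulr_ge0 //; congr sqrtC.
have := moment_neq0 (n + 1 + 1); have := moment_neq0 (n + 1).
have := moment_neq0 n; rewrite /moment !pow2S => ? ? ?; field.
by apply/and3P.
Qed.

Lemma norm_sqrtC_le2 (x : C) : 0 <= x <= 4 -> `|sqrtC x| <= 2.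
Proof.
case/andP=> x0 x4; rewrite ger0_norm ?sqrtC_ge0 // -ler_sqr ?nnegrE ?sqrtC_ge0 //.
by rewrite sqrtCK (le_trans x4) // -natrX.
Qed.

Lemma weight_le2 n :
  [/\ `|weight1 n| <= 2, `|weight2 n| <= 2 & `|weight4 n| <= 2].
Proof.
have m_ge0 k := ltW (moment_gt0 k); have p_ge0 := ltW (pow2_gt0 n).
have m_gt0 := moment_gt0.
split; apply: norm_sqrtC_le2; rewrite divr_ge0 ?mulr_ge0 //=.
- rewrite ler_pdivrMr // /moment pow2S mulrDr mulr1 lerD ?ler1n //.
  by rewrite ler_wpM2r // ler_nat.
- rewrite ler_pdivrMr ?mulr_gt0 //.
  rewrite (@le_trans _ _ (moment n * moment (n + 1))) //; last first.
    by rewrite ler_peMl ?mulr_ge0 // ler1n.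
  rewrite (@le_trans _ _ (moment n)) //; first by rewrite /moment lerDr.
  by rewrite ler_peMr // /moment lerDl ltW // pow2_gt0.
- rewrite ler_pdivrMr // (_ : 4 = 2 * 2); last by rewrite -natrM.
  rewrite -mulrA ler_wpM2l //.
  by rewrite /moment pow2S mulrDr mulrA -natrM lerD ?mulr1 ?ler1n // ler_peMl ?ler1n.
Qed.

End Weights.

(** * Bilateral weighted shifts *)

Section BilateralShifts.
Variables (C : numClosedFieldType) (H : completeNormedModType C).
Variables (dot : {dot H for Num.conj}) (dot_norm : hilbert_norm dot).
Variables (e : int -> H) (e_basis : orthonormal_basis dot e).

(** T is the shift e n |-> w n *: e (n + 1). Nonnegative weights are their own
    conjugates, so the same w gives the coefficients of the adjoint T'. *)
Lemma exists_weighted_shift (w : int -> C) (M : C) : 0 <= M ->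
    (forall n, `|w n| <= M) -> (forall n, 0 <= w n) ->
  exists T T' : {linear H -> H},
    [/\ (forall x, `|T x| <= M * `|x|) /\ (forall x, `|T' x| <= M * `|x|),
        is_adjoint dot T T',
        forall x n, dot (T x) (e (n + 1)) = w n * dot x (e n)
      & forall x n, dot (T' x) (e n) = w n * dot x (e (n + 1))].
Proof.
move=> M0 wM w0.
have predK : cancel (fun n : int => n - 1) (fun n => n + 1).
  by move=> n; rewrite subrK.
have succK : cancel (fun n : int => n + 1) (fun n => n - 1).
  by move=> n; rewrite addrK.
have wM' n : `|w (n - 1)| <= M by [].
have [T TP] := exists_weighted_permutation dot_norm e_basis predK succK M0 wM'.
have [T' TP'] := exists_weighted_permutation dot_norm e_basis succK predK M0 wM.
exists T, T'; split.
- split; first exact (weighted_permutation_le dot_norm e_basis predK M0 wM' TP).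
  exact (weighted_permutation_le dot_norm e_basis succK M0 wM TP').
- apply: (adjoint_weighted_permutation dot_norm e_basis predK succK M0 wM' TP).
  by move=> x n /=; rewrite addrK conj_Creal ?ger0_real // TP'.
- by move=> x n; rewrite TP addrK.
- exact: TP'.
Qed.

Lemma basis_eq_succ x y :
  (forall n, dot x (e (n + 1)) = dot y (e (n + 1))) -> x = y.
Proof.
by move=> xy; apply: (basis_eq dot_norm e_basis) => n; rewrite -(subrK 1 n) xy.
Qed.

(** The range contains every e (n + 1) = T ((w n)^-1 *: e n), hence every Fourier
    sum. *)
Lemma weighted_shift_quasiaffinity (w : int -> C) (M : C) (T : {linear H -> H}) :
  0 <= M -> (forall x, `|T x| <= M * `|x|) ->
  (forall x n, dot (T x) (e (n + 1)) = w n * dot x (e n)) ->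
  (forall n, w n != 0) -> quasiaffinity T.
Proof.
move=> M0 TM TP w0; split; first exact: bounded_operatorP M0 TM.
  move=> x y Txy; apply: (basis_eq dot_norm e_basis) => n.
  by apply: (mulfI (w0 n)); rewrite -!TP Txy.
have Te n : T ((w n)^-1 *: e n) = e (n + 1).
  apply: basis_eq_succ => m.
  rewrite TP linearZl_LR /= !e_basis.1 (inj_eq (addIr 1)).
  by have [->|] := eqVneq n m; rewrite ?mulr0 // mulr1 mulfV.
move=> O [x Ox] O_open.
have /nbhs_normP[eps /= eps0 xO] := open_nbhs_nbhs (conj O_open Ox).
have [s us xs] := e_basis.2 x eps eps0.
exists (fourier dot e s x); split; first exact: xO.
exists (\sum_(n <- s) dot x (e n) *: ((w (n - 1))^-1 *: e (n - 1))) => //.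
rewrite linear_sum; apply: eq_bigr => n _.
by rewrite linearZ /= Te subrK.
Qed.

End BilateralShifts.

(** * The normal operator *)

Theorem theorem3p5 (R : realType) (H : completeNormedModType R[i])
    (dot : {dot H for Num.conj}) (dot_norm : hilbert_norm dot)
    (H_separable : separable H) (H_infinite : ~ finite_dimensional H) :
  exists (D : {linear (H * H)%type -> (H * H)%type})
         (D1 D2 D4 : {linear H -> H}),
    [/\ normal_operator (dsum_dot dot dot) D,
        [/\ bounded_operator D1, bounded_operator D2 & bounded_operator D4],
        forall x y : H, D (x, y) = (D1 x + D2 y, D4 y)
      & quasiaffinity D2].
Proof.
have [e0 e0_basis] := separable_basis dot_norm H_separable H_infinite.
have e_basis := orthonormal_basis_reindex int_nat_bijective e0_basis.
set e := (e0 \o _) in e_basis.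
have le1 n : `|weight1 R[i] n| <= 2 by have [] := weight_le2 R[i] n.
have le2 n : `|weight2 R[i] n| <= 2 by have [] := weight_le2 R[i] n.
have le4 n : `|weight4 R[i] n| <= 2 by have [] := weight_le2 R[i] n.
have M0 : 0 <= 2 :> R[i] by [].
have [D1 [D1' [[b1 b1'] adj1 P1 P1']]] :=
  exists_weighted_shift dot_norm e_basis M0 le1 (@weight1_ge0 _).
have [D2 [D2' [[b2 b2'] adj2 P2 P2']]] :=
  exists_weighted_shift dot_norm e_basis M0 le2 (fun n => ltW (weight2_gt0 _ n)).
have [D4 [D4' [[b4 b4'] adj4 P4 P4']]] :=
  exists_weighted_shift dot_norm e_basis M0 le4 (@weight4_ge0 _).
have b0 x : `|(\0 : {linear H -> H}) x| <= 2 * `|x|.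
  by rewrite normr0 mulr_ge0.
have adj0 : is_adjoint dot (\0 : {linear H -> H}) (\0 : {linear H -> H}).
  by move=> x y /=; rewrite linear0l linear0r.
exists (block D1 D2 \0 D4), D1, D2, D4; split.
- split; first exact: block_bounded M0 b1 b2 b0 b4.
  exists (block D1' \0 D2' D4'); split.
  + exact: block_bounded M0 b1' b0 b2' b4'.
  + exact: block_adjoint adj1 adj2 adj0 adj4.
  + move=> [x y]; apply: injective_projections;
      rewrite /block /= !(addr0, add0r);
      apply: (basis_eq_succ dot_norm e_basis) => n.
    (* On the first summand: D1' D1 = D1 D1' + D2 D2' and D1' D2 = D2 D4'. *)
    * rewrite P1' !linearDl /= !P1 !P2 P1' linearDl /= P2' P4'.
      rewrite !mulrDr !mulrA -!expr2 weight1_sqr weight_intertwine.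
      by rewrite mulrDl addrA [weight4 _ _ * _]mulrC.
    (* On the second summand: D2' D1 = D4 D2' and D2' D2 + D4' D4 = D4 D4'. *)
    * rewrite linearDl /= P2' P4' !P4 !linearDl /= P1 P2 P2' P4'.
      rewrite !mulrDr !mulrA -!expr2 (weight4_sqr _ n) -weight_intertwine.
      by rewrite [weight2 _ _ * weight1 _ _]mulrC mulrDl [X in _ = _ + X]addrC addrA.
- by split; [exact: bounded_operatorP M0 b1|exact: bounded_operatorP M0 b2
            |exact: bounded_operatorP M0 b4].
- by move=> x y; rewrite /= /block /= add0r.
- apply: (weighted_shift_quasiaffinity dot_norm e_basis M0 b2 P2) => n.
  exact: lt0r_neq0 (weight2_gt0 _ n).
Qed.
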